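(* Let $F$ be a field of characteristic $0$. (a) If an $F$-algebra $A$ satisfies a polynomial identity of degree $d$, then $A$ satisfies a nontrivial strong identity of degree $d'=\lceil e(d-1)^4\rceil^2$ (with $e=2.71828\ldots$). (b) If moreover $A=F\{a_1,\dots,a_r\}$ is affine and $d'$ is as in (a), then for $n=r^{d'}+d'$, $A$ satisfies the Capelli identity $\mathrm{Cap}_n$. In particular every affine PI algebra over a field of characteristic $0$ satisfies some Capelli identity.
   Context: $V_m$ denotes the space of multilinear polynomials in $x_1,\dots,x_m$, identified with $F[S_m]$ via $\sigma\leftrightarrow x_{\sigma(1)}\cdots x_{\sigma(m)}$. $S_m$ acts on $V_m$ on the left by $\sigma p(x_1,\dots,x_m)=p(x_{\sigma(1)},\dots,x_{\sigma(m)})$ and on the right by place permutations: $(x_{\tau(1)}\cdots x_{\tau(m)})\pi=x_{\tau\pi(1)}\cdots x_{\tau\pi(m)}$ with the convention $\tau\pi(i)=\pi(\tau(i))$. For $n\le m$, $V_n\subseteq V_m$ via $g\mapsto g\,x_{n+1}\cdots x_m$. $\mathrm{Id}(A)$ is the set of polynomial identities of $A$. A nonzero $g\in V_n$ is a strong identity of $A$ if for every $m\ge n$, $F[S_m]\,g\,F[S_m]\subseteq\mathrm{Id}(A)$. $\mathrm{Cap}_n(x_1,\dots,x_n;y_1,\dots,y_n)=\sum_{\pi\in S_n}\operatorname{sgn}(\pi)x_{\pi(1)}y_1\cdots x_{\pi(n)}y_n$. *)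

(* Defs.v *)
From HB Require Import structures.
From mathcomp Require Import all_boot all_order all_algebra all_fingroup.
From Stdlib Require Reals.
From mathcomp Require Import Rstruct.
Set Implicit Arguments. Unset Strict Implicit. Unset Printing Implicit Defensive.
Import Order.TTheory GRing.Theory Num.Theory.
Local Open Scope ring_scope.

Definition e_ceil (d : nat) : int :=
  Num.ceil (Rtrigo_def.exp (1 : Rdefinitions.R) * ((d.-1) ^ 4)%N%:R).
Definition dprime (d : nat) : nat := (`|e_ceil d| ^ 2)%N.

Section PI.
Variables (F : fieldType) (A : algType F).

(* A (noncommutative) polynomial of degree <= d in variables x_0..x_{k-1} is
   given by a coefficient function on words; only words of length <= d count.
   Its value at x : 'I_k -> A. *)
Definition ncpoly_eval (k d : nat) (c : seq 'I_k -> F) (x : 'I_k -> A) : A :=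
  \sum_(j < d.+1) \sum_(w : j.-tuple 'I_k) c w *: \prod_(i <- w) x i.

Definition has_PI_of_degree (d : nat) : Prop :=
  exists (k : nat) (c : seq 'I_k -> F),
    (exists w : d.-tuple 'I_k, c w != 0) /\
    forall x : 'I_k -> A, ncpoly_eval d c x = 0.

(* V_m identified with F[S_m]: f <-> sum_s f s x_{s(1)}...x_{s(m)}. *)
Definition mlin_eval (m : nat) (f : {ffun 'S_m -> F}) (x : 'I_m -> A) : A :=
  \sum_(s : 'S_m) f s *: \prod_(i < m) x (s i).

Definition mlin_identity (m : nat) (f : {ffun 'S_m -> F}) : Prop :=
  forall x : 'I_m -> A, mlin_eval f x = 0.

(* product in the group algebra F[S_m]; mathcomp's (s * t) i = t (s i),
   matching the paper's convention tau pi (i) = pi (tau i). *)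
Definition galg_mul (m : nat) (a b : {ffun 'S_m -> F}) : {ffun 'S_m -> F} :=
  [ffun r : 'S_m => \sum_(s : 'S_m) a s * b (s^-1 * r)%g].

Definition ext_val (n m : nat) (s : 'S_n) (i : 'I_m) : nat :=
  if insub (val i) is Some j then val (s j) else val i.

(* embedding V_n -> V_m, g |-> g x_{n+1} ... x_m *)
Definition embed_mlin (n m : nat) (g : {ffun 'S_n -> F}) : {ffun 'S_m -> F} :=
  [ffun r : 'S_m => \sum_(s : 'S_n | [forall i : 'I_m, val (r i) == ext_val s i]) g s].

Definition strong_identity (n : nat) (g : {ffun 'S_n -> F}) : Prop :=
  g != 0 /\
  forall m : nat, (n <= m)%N ->
    forall a b : {ffun 'S_m -> F},
      mlin_identity (galg_mul (galg_mul a (embed_mlin m g)) b).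

Definition generates (r : nat) (a : 'I_r -> A) : Prop :=
  forall y : A, exists s : seq (F * seq 'I_r),
    y = \sum_(p <- s) p.1 *: \prod_(i <- p.2) a i.

Definition satisfies_Capelli (n : nat) : Prop :=
  forall x y : 'I_n -> A,
    \sum_(p : 'S_n) ((-1) ^+ odd_perm p : F) *: \prod_(i < n) (x (p i) * y i) = 0.

End PI.

(* Main.v *)
Require Import Defs.
From HB Require Import structures.
From mathcomp Require Import all_boot all_order all_algebra all_fingroup.
From mathcomp Require Import zify Rstruct.
Set Implicit Arguments. Unset Strict Implicit. Unset Printing Implicit Defensive.
Import Order.TTheory GRing.Theory Num.Theory.
Local Open Scope ring_scope.

(* Codimension bound (Latyshev). A multilinear identity of degree d = q + 1 lets
   one rewrite a word with a decreasing subsequence of length d in terms of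
   lexicographically smaller ones, and at most q^(2m) permutations of m letters
   have no such subsequence: color each letter by the length of a longest
   decreasing subsequence starting there; the colors by position together with
   the colors by letter determine the permutation.

   (a) No representation theory is needed. In F[S_n] the elements that vanish on
   x_1 y_1 ... x_n y_n, for arbitrary y, form a right ideal of codimension
   k <= q^(4n). Its largest two-sided ideal is the annihilator of a module of
   dimension k, so has codimension at most k^2 <= q^(8n). This is less than n!
   for n = dprime d >= 4 q^8, because n! >= (n/3)^n; so there is a nonzero g in
   that ideal.

   (b) By multilinearity it suffices to evaluate the alternating variables of the
   Capelli polynomial at words in the generators. If two words coincide the value
   is 0; otherwise at least D = dprime d of them have length >= D, and the strong
   identity transfers letters between them so as to increase the sum of the
   squares of the lengths, which is bounded. *)

(** * Least moved points and cancelling signed sums *)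

(** Everything below the least moved point is fixed, so by injectivity its image lies above it.
    Lexicographic descent and exchange arguments start from this point. *)
Lemma first_moved_point n (s : 'S_n) : s != 1%g ->
  exists i : 'I_n, (i < s i)%N /\ forall j : 'I_n, (j < i)%N -> s j = j.
Proof.
move=> sN1; have [i0 si0] : exists i, s i != i.
  apply/existsP; apply: contraNT sN1 => /existsPn sid.
  by apply/eqP/permP => i; rewrite perm1; apply/eqP; rewrite -[_ == _]negbK sid.
case: (@arg_minnP _ i0 (fun i => s i != i) val si0) => i si imin.
have fixed (j : 'I_n) : (j < i)%N -> s j = j.
  by move=> ji; apply/eqP/negPn/negP => /imin; rewrite leqNgt ji.
exists i; split=> //; rewrite ltnNge leq_eqVlt; apply/negP => /orP[/eqP/val_inj|].
  by apply/eqP.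
by move=> /fixed /perm_inj /eqP; apply/negP.
Qed.

Section SignedSum.
Variables (F : fieldType) (A : lmodType F).

(** Reindexing one parity class by [h] gives minus the sum over the other class; no division by 2
    occurs. *)
Lemma signed_sum_eq0 n (h : 'S_n -> 'S_n) (Phi : 'S_n -> A) :
  injective h -> (forall p, odd_perm (h p) = ~~ odd_perm p) ->
  (forall p, Phi (h p) = Phi p) ->
  \sum_(p : 'S_n) ((-1) ^+ odd_perm p : F) *: Phi p = 0.
Proof.
move=> h_inj h_odd Phi_h.
rewrite (bigID (@odd_perm _)) /= (reindex_inj h_inj) -[LHS]addrC.
apply/eqP; rewrite addr_eq0 -sumrN; apply/eqP.
apply: eq_big => [p|p Np]; first by rewrite h_odd.
by rewrite h_odd (negPf Np) Phi_h expr1 expr0 scaleN1r opprK scale1r.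
Qed.

(** Toggling the membership of [j0] is a sign-reversing involution on the sets satisfying [P]. *)
Lemma signed_subset_sum_eq0 (T : finType) (P : pred {set T}) (j0 : T) :
  (forall S, P (S :\ j0) = P S) -> (forall S, P (j0 |: S) = P S) ->
  \sum_(S : {set T} | P S) ((-1) ^+ #|S| : F) = 0.
Proof.
move=> P_del P_add; rewrite (bigID (fun S : {set T} => j0 \in S)) /=.
rewrite (reindex_onto (fun S => j0 |: S) (fun S => S :\ j0)) /=; last first.
  by move=> S /andP[_ jS]; rewrite setD1K.
apply/eqP; rewrite addr_eq0 -sumrN; apply/eqP.
apply: eq_big => [S|S].
  rewrite setU11 P_add andbT; case: (boolP (j0 \in S)) => jS; last by rewrite setU1K ?eqxx.
  by rewrite andbF; apply/negbTE/negP => /andP[_ /eqP E]; move: jS; rewrite -E !inE eqxx.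
case/andP=> _ /eqP E; have jS : j0 \notin S by rewrite -E !inE eqxx.
by rewrite cardsU1 jS exprS mulN1r.
Qed.
End SignedSum.

(** * Multilinearization of a polynomial identity *)

Section Multilinearization.
Variables (F : fieldType) (A : algType F).

(* Substitute [x i := \sum_(j in S | tnth w0 j == i) z j] and take the
   alternating sum over [S]: only the monomials involving every [z j] survive,
   and those have degree exactly [d]. *)
Lemma multilinearization d : has_PI_of_degree A d ->
  exists f : {ffun 'S_d -> F}, f 1%g != 0 /\ mlin_identity A f.
Proof.
case=> k [c [[w0 cw0] PI]].
exists [ffun s : 'S_d => c [seq tnth w0 (s p) | p <- enum 'I_d]]; split.
  rewrite ffunE; suff -> : [seq tnth w0 ((1%g : 'S_d) p) | p <- enum 'I_d] = w0 by [].
  by rewrite -[RHS]map_tnth_enum; apply: eq_map => p; rewrite perm1.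
move=> z.
pose xS (S : {set 'I_d}) i := \sum_(j | (j \in S) && (tnth w0 j == i)) z j.
have evalE S : ncpoly_eval d c (xS S) = \sum_(j < d.+1)
    \sum_(phi : {ffun 'I_j -> 'I_d} | [forall p, phi p \in S])
      c [seq tnth w0 (phi p) | p <- enum 'I_j] *: \prod_p z (phi p).
  rewrite /ncpoly_eval; apply: eq_bigr => j _.
  rewrite (partition_big (fun phi : {ffun 'I_j -> 'I_d} =>
     [tuple tnth w0 (phi p) | p < j]) predT) //=; apply: eq_bigr => w _.
  rewrite big_tuple /xS (bigA_distr_big_dep (fun i j => (j \in S) && (tnth w0 j == tnth w i))).
  rewrite scaler_sumr; apply: eq_big => [phi|phi /forallP phiP].
    apply/familyP/andP => [phiP|[/forallP phiS /eqP <- p]].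
      split; first by apply/forallP => p; case/andP: (phiP p).
      by apply/eqP/eq_from_tnth => p; rewrite tnth_mktuple; case/andP: (phiP p) => _ /eqP.
    by apply/andP; rewrite phiS tnth_mktuple.
  congr (c _ *: _); rewrite -[LHS]map_tnth_enum; apply: eq_map => p.
  by case/andP: (phiP p) => _ /eqP.
have : \sum_(S : {set 'I_d}) ((-1) ^+ #|S| : F) *: ncpoly_eval d c (xS S) = 0.
  by rewrite big1 // => S _; rewrite PI scaler0.
under eq_bigr => S _ do (rewrite evalE scaler_sumr; under eq_bigr => j _ do rewrite big_mkcond scaler_sumr).
rewrite exchange_big /=.
under eq_bigr => j _ do rewrite exchange_big /=.
(* Inclusion-exclusion: a point missed by [phi] can be toggled in [S], so only surjective [phi]
   contribute. *)
have inner (j : nat) (phi : {ffun 'I_j -> 'I_d}) (V : A) :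
   \sum_(S : {set 'I_d}) ((-1) ^+ #|S| : F) *: (if [forall p, phi p \in S] then V else 0)
   = (if [forall i, i \in codom phi] then (-1) ^+ d else 0 : F) *: V.
  transitivity ((\sum_(S : {set 'I_d} | [forall p, phi p \in S]) ((-1) ^+ #|S| : F)) *: V).
    by rewrite scaler_suml [RHS]big_mkcond; apply: eq_bigr => S _; case: ifP; rewrite ?scaler0.
  congr (_ *: _); case: ifPn => [/forallP surj|/forallPn[j0 j0N]].
    rewrite (big_pred1 setT) => [|S]; first by rewrite cardsT card_ord.
    apply/forallP/eqP => [PS|-> p]; last by rewrite inE.
    by apply/setP => i; rewrite inE; case/codomP: (surj i) => p ->; rewrite PS.
  have neq p : (phi p == j0) = false.
    by apply: contraNF j0N => /eqP <-; apply: codom_f.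
  by apply: (@signed_subset_sum_eq0 _ _ _ j0) => S; apply: eq_forallb => p; rewrite !inE neq.
under eq_bigr => j _ do under eq_bigr => phi _ do rewrite inner.
(* Below degree [d] no [phi] is surjective; in degree [d] the surjective ones are the
   permutations. *)
rewrite big_ord_recr /= big1 ?add0r; last first.
  move=> j _; apply: big1 => phi _; rewrite ifF ?scale0r //.
  apply: contraTF (ltn_ord j) => /forallP surj; rewrite -leqNgt.
  rewrite -[leqLHS](card_ord d) -[leqRHS](card_ord j).
  apply: leq_trans (leq_image_card phi predT).
  by apply/subset_leq_card/subsetP => i _; apply: surj.
have codom_inj (phi : {ffun 'I_d -> 'I_d}) :
    [forall i, i \in codom phi] = injectiveb phi.
  apply/forallP/injectiveP => [surj|phi_inj i]; last exact: (injF_onto phi_inj).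
  apply/injectiveP/card_uniqP; rewrite size_codom; apply: eq_card => i.
  by rewrite (surj i).
under eq_bigr => phi _ do rewrite codom_inj (fun_if (fun a => a *: _)) scale0r.
rewrite -big_mkcond /= (reindex (@pval _)) /=; last first.
  pose in_Sn := insubd (1%g : 'S_d).
  by exists in_Sn => /= f Uf; first apply: val_inj; apply: insubdK.
rewrite (eq_bigl xpredT) => [|s]; last by rewrite (valP s).
rewrite -scaler_sumr => /eqP; rewrite scaler_eq0 signr_eq0 /= => /eqP sum0.
rewrite /mlin_eval -[RHS]sum0; apply: eq_bigr => s _; rewrite ffunE.
by congr (c _ *: _); [apply: eq_map => p|apply: eq_bigr => p _]; rewrite pvalE.
Qed.
End Multilinearization.

(* Unlike [big_enum], no commutativity is needed. *)
Lemma big_enumT (R : Type) (idx : R) (op : R -> R -> R) (I : finType) (E : I -> R) :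
  \big[op/idx]_(i <- enum I) E i = \big[op/idx]_i E i.
Proof. by rewrite enumT [index_enum I]unlock. Qed.

(** * Words without long decreasing subsequences *)

(* For [a] in a duplicate-free [w], [lab w a + 1] is the maximal length of a
   strictly decreasing subsequence of [w] starting at [a]. *)
Fixpoint lab (w : seq nat) (a : nat) : nat :=
  if w is b :: w' then
    if a == b then (\max_(c <- w' | c < b) (lab w' c).+1)%N else lab w' a
  else 0%N.

(** For a duplicate-free word: no decreasing subsequence has length [q.+1]. *)
Definition good (q : nat) (w : seq nat) : bool := all (fun a => lab w a < q)%N w.

Definition good_words (q : nat) (w : seq nat) : seq (seq nat) :=
  [seq v <- permutations w | good q v].

Lemma lab_head w a b : a \in w -> (a < b)%N -> (lab w a < lab (b :: w) b)%N.
Proof.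
by move=> aw ab; rewrite /= eqxx; apply: (@leq_bigmax_seq _ w _ (fun c => (lab w c).+1)).
Qed.

Lemma lab_tail w a b : a != b -> lab (b :: w) a = lab w a.
Proof. by move=> /negbTE /= ->. Qed.

(** Cut the word before each letter of a longest decreasing subsequence starting at [a]. These
    blocks are what will be substituted into the identity. *)
Lemma lab_decreasing w a : a \in w -> exists w0 (ws : seq (seq nat)),
  [/\ w = w0 ++ flatten ws, size ws = (lab w a).+1, all (fun s => s != [::]) ws,
      sorted gtn (map (head 0%N) ws) & head 0%N (head [::] ws) = a].
Proof.
elim: w a => [//|b w IH] a; rewrite inE /=; case: eqVneq => [-> _|_ /= /IH].
  have: (\max_(c <- w | c < b) (lab w c).+1 = 0)%N \/ exists2 c,
      (c \in w) && (c < b)%N & (\max_(c <- w | c < b) (lab w c).+1 = (lab w c).+1)%N.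
    rewrite big_seq_cond.
    apply: (big_ind (fun m => m = 0%N \/ exists2 c, (c \in w) && (c < b)%N & m = (lab w c).+1)).
    - by left.
    - by move=> m1 m2 H1 H2; case: (leqP m1 m2).
    - by move=> c cP; right; exists c.
  case=> [->|[c /andP[cw cb] ->]]; first by exists [::], [:: b :: w]; rewrite /= cats0.
  have [w0 [ws [wE sz ne srt hd]]] := IH _ cw.
  exists [::], ((b :: w0) :: ws); split=> //=; rewrite ?sz // -?wE //.
  by case: ws sz srt hd {wE ne} => //= s ws _ srt E; rewrite E cb -E.
case=> w0 [ws [wE sz ne srt hd]]; exists (b :: w0), ws.
by split=> //=; rewrite -wE.
Qed.

Lemma bad_factorization q w : ~~ good q w ->
  exists w0 w1 (b : 'I_q.+1 -> seq nat),
  [/\ w = w0 ++ flatten (map b (enum 'I_q.+1)) ++ w1, forall i, b i != [::]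
    & forall i j : 'I_q.+1, (i < j)%N -> (head 0%N (b j) < head 0%N (b i))%N].
Proof.
case/allPn => a aw; rewrite -leqNgt => qa.
have [w0 [ws [wE sz /allP ne srt _]]] := lab_decreasing aw.
have szq : (q.+1 <= size ws)%N by rewrite sz.
exists w0, (flatten (drop q.+1 ws)), (fun i => nth [::] ws i); split.
- rewrite {1}wE; congr (_ ++ _); rewrite -flatten_cat; congr flatten.
  rewrite -[LHS](cat_take_drop q.+1); congr (_ ++ _).
  rewrite -[RHS]/(map (nth [::] ws \o val) _) map_comp val_enum_ord.
  by rewrite map_nth_iota0.
- by move=> i; apply/ne/mem_nth/(leq_trans (ltn_ord i)).
- move=> i j ij; have ltsz (k : 'I_q.+1) : (k < size ws)%N by apply: leq_trans szq.
  have gtn_tr : transitive gtn by move=> x y z /= xy yz; apply: ltn_trans xy.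
  have := @sorted_ltn_nth _ gtn gtn_tr 0%N _ srt i j.
  by rewrite !inE size_map !(nth_map [::]) ?ltsz // => /(_ isT isT ij).
Qed.

(* The number written [w] in base [B]: it orders the words of a given length
   with letters less than [B] lexicographically. *)
Fixpoint wval (B : nat) (w : seq nat) : nat :=
  if w is a :: w' then (a * B ^ size w' + wval B w')%N else 0%N.

Lemma wval_bound B w : all (fun a => a < B)%N w -> (wval B w < B ^ size w)%N.
Proof.
elim: w => //= a w IH /andP[aB /IH lt].
apply: (@leq_trans (a.+1 * B ^ size w)); first by rewrite mulSn addnC ltn_add2r.
by rewrite expnS leq_mul2r aB orbT.
Qed.

Lemma wval_lt B p a r a' r' : size r = size r' -> all (fun a => a < B)%N r ->
  (a < a')%N -> (wval B (p ++ a :: r) < wval B (p ++ a' :: r'))%N.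
Proof.
move=> sz rB aa'; elim: p => [|c p IH] /=; last by rewrite !size_cat /= sz ltn_add2l.
apply: (@leq_trans (a.+1 * B ^ size r)).
  by rewrite mulSn addnC ltn_add2r wval_bound.
by rewrite sz; apply: leq_trans (leq_addr _ _); rewrite leq_mul2r aa' orbT.
Qed.

(** If the first letters differed, the smaller one would occur in the word headed by the larger one,
    with a strictly smaller label than that head; but the labels by position and by letter make the
    two equal. Removing a common head changes no other label. *)
Lemma good_words_inj v v' : uniq v -> perm_eq v v' ->
  map (lab v) v = map (lab v') v' -> {in v, lab v =1 lab v'} -> v = v'.
Proof.
have heads b b' u u' : lab (b :: u) b = lab (b' :: u') b' ->
    lab (b :: u) b = lab (b' :: u') b -> b \in b' :: u' -> ~ (b < b')%N.
  move=> E1 E2 bu lt; have ne : b != b' by rewrite neq_ltn lt.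
  move: bu; rewrite inE (negbTE ne) /= => /lab_head /(_ lt).
  by rewrite -E1 E2 lab_tail // ltnn.
elim: v v' => [|b v IH] [|b' v'] //; try by move=> _ /perm_size.
move=> uv pv maps vals; have uv' : uniq (b' :: v') by rewrite -(perm_uniq pv).
have hd : lab (b :: v) b = lab (b' :: v') b' by apply: (congr1 (head 0%N) maps).
have bv' : b \in b' :: v' by rewrite -(perm_mem pv) mem_head.
have b'v : b' \in b :: v by rewrite (perm_mem pv) mem_head.
have bb' : b = b'.
  case: (ltngtP b b') => // lt; exfalso.
    exact: (heads b b' v v' hd (vals _ (mem_head _ _)) bv' lt).
  exact: (heads b' b v' v (esym hd) (esym (vals _ b'v)) b'v lt).
subst b'; congr (_ :: _).
case/andP: uv => bNv uv; case/andP: uv' => bNv' uv'.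
have tl (u : seq nat) : b \notin u -> {in u, lab (b :: u) =1 lab u}.
  by move=> bNu a au; rewrite lab_tail //; apply: contraNneq bNu => <-.
have pvv' : perm_eq v v' by rewrite perm_cons in pv.
apply: IH => // [|a av].
  move/eq_in_map: (tl v bNv) => <-; move/eq_in_map: (tl v' bNv') => <-.
  exact: (congr1 behead maps).
by rewrite -tl // vals ?inE ?av ?orbT // tl // -(perm_mem pvv').
Qed.

Lemma size_good_words q m : (size (good_words q (iota 0 m)) <= q ^ m * q ^ m)%N.
Proof.
(* For [q = 0] only the empty word is good; otherwise the labels can be stored in ['I_q.+1]. *)
case: q => [|q].
  case: m => [|m]; first by rewrite /good_words /= /good.
  rewrite exp0n // leqn0 size_eq0 -[_ == _]negbK -has_filter -all_predC; apply/allP => v.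
  by rewrite mem_permutations => /perm_size; case: v.
pose f v : {ffun 'I_m -> 'I_q.+1} * {ffun 'I_m -> 'I_q.+1} :=
  ([ffun i : 'I_m => inord (lab v (nth 0%N v i))], [ffun i : 'I_m => inord (lab v i)]).
have -> : size (good_words q.+1 (iota 0 m)) = size (map f (good_words q.+1 (iota 0 m))).
  by rewrite size_map.
have /card_uniqP <- : uniq (map f (good_words q.+1 (iota 0 m))).
  rewrite map_inj_in_uniq ?filter_uniq ?permutations_uniq // => v v'.
  rewrite !mem_filter !mem_permutations => /andP[/allP gv pv] /andP[/allP gv' pv'] [].
  move=> /ffunP E1 /ffunP E2.
  have szv : size v = m by rewrite (perm_size pv) size_iota.
  have szv' : size v' = m by rewrite (perm_size pv') size_iota.
  have pvv' : perm_eq v v' by rewrite (permPl pv) perm_sym.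
  have inordK_lab u a : (lab u a < q.+1)%N -> val (inord (lab u a) : 'I_q.+1) = lab u a.
    by move=> lt; rewrite /= inordK.
  apply: good_words_inj => //; first by rewrite (perm_uniq pv) iota_uniq.
    apply: (@eq_from_nth _ 0%N); first by rewrite !size_map szv.
    move=> i; rewrite size_map szv => im; rewrite !(nth_map 0%N) ?szv ?szv' //.
    have := E1 (Ordinal im); rewrite !ffunE => /(congr1 val).
    by rewrite !inordK_lab //= ?gv ?gv' ?mem_nth ?szv ?szv'.
  move=> a av; have am : (a < m)%N by move: av; rewrite (perm_mem pv) mem_iota add0n.
  have := E2 (Ordinal am); rewrite !ffunE => /(congr1 val).
  by rewrite !inordK_lab //= ?gv ?gv' // -(perm_mem pvv').
by apply: leq_trans (max_card _) _; rewrite card_prod card_ffun !card_ord.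
Qed.

(** * Good words span modulo the identities of [A] *)

Section Reduction.
Variables (F : fieldType) (A : algType F).

Definition wprod (x : nat -> A) (w : seq nat) : A := \prod_(i <- w) x i.

(** The same coefficients serve all evaluations [x], so this is a congruence modulo the identities
    of [A]. *)
Definition reducible (gs : seq (seq nat)) (E : (nat -> A) -> A) : Prop :=
  exists c : seq nat -> F, forall x, E x = \sum_(v <- gs) c v *: wprod x v.

Lemma reducible_sum gs (T : finType) (P : pred T) (c : T -> F) E :
  (forall t, P t -> reducible gs (E t)) ->
  reducible gs (fun x => \sum_(t | P t) c t *: E t x).
Proof.
move=> redE; have /fin_all_exists[C CE] t : exists C : seq nat -> F,
    P t -> forall x, E t x = \sum_(v <- gs) C v *: wprod x v.
  by case: (boolP (P t)) => [/redE[C CE]|_]; [exists C|exists (fun=> 0)].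
exists (fun v => \sum_(t | P t) c t * C t v) => x.
under eq_bigr => t Pt do rewrite (CE t Pt) scaler_sumr.
rewrite exchange_big; apply: eq_bigr => v _ /=; rewrite scaler_suml.
by apply: eq_bigr => t _; rewrite scalerA.
Qed.

Lemma wprod_cat x u v : wprod x (u ++ v) = wprod x u * wprod x v.
Proof. exact: big_cat. Qed.

Lemma wprod_flatten x (I : Type) (b : I -> seq nat) s :
  wprod x (flatten (map b s)) = \prod_(i <- s) wprod x (b i).
Proof. by rewrite /wprod big_flatten big_map. Qed.

(** Induction on [wval]: the identity trades a word that is not good for words with permuted blocks,
    all lexicographically smaller. *)
Lemma good_words_span q (f : {ffun 'S_q.+1 -> F}) w0 w :
  f 1%g != 0 -> mlin_identity A f -> perm_eq w w0 ->
  reducible (good_words q w0) (wprod^~ w).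
Proof.
move=> f1 fid pw; pose B := (\max_(a <- w0) a).+1.
have ltB v : perm_eq v w0 -> all (fun a => a < B)%N v.
  move=> pv; apply/allP => a; rewrite (perm_mem pv) ltnS => aw.
  exact: (@leq_bigmax_seq _ w0 xpredT id).
have [n] := ubnP (wval B w); elim: n => // n IH in w pw *; rewrite ltnS => wn.
case: (boolP (good q w)) => [gw|/bad_factorization[u [u' [b [wE ne dec]]]]].
  exists (fun v => (v == w)%:R) => x.
  rewrite (bigD1_seq w) ?filter_uniq ?permutations_uniq //=; last first.
    by rewrite mem_filter gw mem_permutations.
  by rewrite eqxx scale1r big1 ?addr0 // => v /negbTE ->; rewrite scale0r.
pose ws (s : 'S_q.+1) := u ++ flatten (map (b \o s) (enum 'I_q.+1)) ++ u'.
have wsP x (s : 'S_q.+1) : wprod x (ws s) = wprod x u * \prod_i wprod x (b (s i)) * wprod x u'.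
  by rewrite /ws !wprod_cat wprod_flatten mulrA big_enumT.
(* Substitute the blocks into [f] and solve for the term of the identity permutation. *)
have key x : wprod x w = \sum_(s : 'S_q.+1 | s != 1%g) (- (f s / f 1%g)) *: wprod x (ws s).
  have -> : wprod x w = wprod x (ws 1%g).
    by rewrite wE /ws; congr (wprod x (_ ++ flatten _ ++ _)); apply: eq_map => i /=; rewrite perm1.
  have := fid (fun i => wprod x (b i)); rewrite /mlin_eval (bigD1 1%g) //=.
  move=> /(congr1 (fun a => wprod x u * ((f 1%g)^-1 *: a) * wprod x u')).
  rewrite scaler0 mulr0 mul0r scalerDr scalerA mulVf // scale1r mulrDr mulrDl -wsP.
  move/eqP; rewrite addr_eq0 => /eqP ->.
  rewrite scaler_sumr mulr_sumr mulr_suml -sumrN; apply: eq_bigr => s _.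
  by rewrite wsP scalerA -scalerAr -scalerAl scaleNr mulrC.
have [s sN1|c cE] := @reducible_sum (good_words q w0) 'S_q.+1 (fun s => s != 1%g)
    (fun s => - (f s / f 1%g)) (fun s => wprod^~ (ws s)); last first.
  by exists c => x; rewrite key cE.
have pws : perm_eq (ws s) w.
  rewrite wE /ws perm_cat2l perm_cat2r map_comp; apply/perm_flatten/perm_map.
  apply: uniq_perm; [by rewrite (map_inj_uniq perm_inj) enum_uniq|exact: enum_uniq|].
  move=> i; rewrite mem_enum inE; apply/mapP.
  by exists (s^-1%g i); rewrite ?mem_enum ?permKV.
have pws0 : perm_eq (ws s) w0 by rewrite (permPl pws).
apply: IH => //; apply: leq_trans wn.
(* The words agree before block [i], where the new block [b (s i)] has the smaller head because
   [i < s i]. *)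
have [i [isi fixed]] := first_moved_point sN1.
have enumE : enum 'I_q.+1 = take i (enum 'I_q.+1) ++ i :: drop i.+1 (enum 'I_q.+1).
  rewrite -[LHS](cat_take_drop i) (drop_nth ord0) ?size_enum_ord //; congr (_ ++ _ :: _).
  by apply: val_inj; rewrite /= nth_enum_ord.
have := dec _ _ isi; have := ne (s i); have := ne i.
move: (ltB _ pws0) (perm_size pws); rewrite wE /ws enumE !map_cat !flatten_cat /=.
have -> : map (b \o s) (take i (enum 'I_q.+1)) = map b (take i (enum 'I_q.+1)).
  apply/eq_in_map => j /(map_f val); rewrite map_take val_enum_ord take_iota mem_iota /=.
  by rewrite leq_min => /andP[ji _] /=; rewrite fixed.
case: (b i) => // a r; case: (b (s i)) => // a' r' /= allB sz _ _ lt.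
rewrite -!catA /= !(catA u) in allB sz *. apply: wval_lt => //.
  by move: sz; rewrite (size_cat _ (a' :: _)) (size_cat _ (a :: _)) => /addnI [].
by move: allB; rewrite all_cat => /andP[_ /andP[]].
Qed.
End Reduction.

(** * Linear systems and generalized inverses *)

Section LinearSystems.
Variable F : fieldType.

Lemma nontrivial_solution (I J : finType) (M : I -> J -> F) : (#|J| < #|I|)%N ->
  exists g : {ffun I -> F}, g != 0 /\ forall j, \sum_i g i * M i j = 0.
Proof.
move=> ltJI; pose B : 'M[F]_(#|I|, #|J|) := \matrix_(i, j) M (enum_val i) (enum_val j).
have kerN0 : kermx B != 0.
  by rewrite -mxrank_eq0 mxrank_ker -lt0n subn_gt0; apply: leq_ltn_trans (rank_leq_col _) ltJI.
pose v := nz_row (kermx B).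
have vB : v *m B = 0 by apply/sub_kermxP/nz_row_sub.
exists [ffun i => v 0 (enum_rank i)]; split.
  have : v != 0 by rewrite nz_row_eq0.
  apply: contra => /eqP/ffunP g0; apply/eqP/rowP => i; rewrite mxE.
  by have := g0 (enum_val i); rewrite !ffunE enum_valK.
move=> j; move/matrixP/(_ 0 (enum_rank j)): vB; rewrite !mxE => vB.
rewrite -[RHS]vB (reindex enum_rank) /=; last by apply/onW_bij/enum_rank_bij.
by apply: eq_bigr => i _; rewrite ffunE !mxE !enum_rankK.
Qed.

(* A generalized inverse [P] of [T]: every [h] differs from a combination of
   the rows of [P] by an element of the kernel of [T]. *)
Lemma generalized_inverse (I J : finType) (T : I -> J -> F) :
  exists P : J -> I -> F, forall (h : I -> F) j,
    \sum_i (h i - \sum_k (\sum_l h l * T l k) * P k i) * T i j = 0.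
Proof.
pose B : 'M[F]_(#|I|, #|J|) := \matrix_(i, j) T (enum_val i) (enum_val j).
exists (fun j i => pinvmx B (enum_rank j) (enum_rank i)) => h j.
pose v : 'rV[F]_#|I| := \row_i h (enum_val i).
have vBE k : (v *m B) 0 (enum_rank k) = \sum_l h l * T l k.
  rewrite mxE (reindex enum_rank) /=; last by apply/onW_bij/enum_rank_bij.
  by apply: eq_bigr => i _; rewrite !mxE !enum_rankK.
have : (v - v *m B *m pinvmx B) *m B = 0.
  by rewrite mulmxBl mulmxKpV ?submxMl // subrr.
move/matrixP/(_ 0 (enum_rank j)); rewrite mxE [RHS]mxE => zero; rewrite -[RHS]zero.
rewrite [RHS](reindex enum_rank) /=; last by apply/onW_bij/enum_rank_bij.
apply: eq_bigr => i _; rewrite [B _ _]mxE !enum_rankK; congr (_ * _).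
rewrite [RHS]mxE [v _ _]mxE [X in _ = _ + X]mxE enum_rankK; congr (_ - _).
rewrite [RHS]mxE [RHS](reindex enum_rank) /=; last by apply/onW_bij/enum_rank_bij.
by apply: eq_bigr => k _; rewrite vBE.
Qed.
End LinearSystems.

(** * Interleaved identities and strong identities *)

Section StrongIdentities.
Variables (F : fieldType) (A : algType F).

(* The left ideal generated by [g] consists of identities even after inserting
   arbitrary elements of [A] between the variables. *)
Definition interleaved_identity n (g : {ffun 'S_n -> F}) : Prop :=
  forall (t : 'S_n) (x y : 'I_n -> A),
    \sum_(s : 'S_n) g s *: \prod_(i < n) (x (s (t i)) * y i) = 0.

Lemma perm_eq_interleave (T : Type) (U : eqType) (a b : T -> U) s :
  perm_eq (flatten [seq [:: a i; b i] | i <- s]) (map a s ++ map b s).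
Proof.
elim: s => //= i s IH.
by rewrite perm_cons perm_sym perm_catC /= perm_cons perm_catC perm_sym.
Qed.

(* The reduction to good words gives a linear map [T] from [F[S_n]] to a space
   of dimension [#|good|] whose kernel consists of interleaved identities.
   These form a right ideal, so [g] has the required property as soon as
   [T (h * g) = 0] for [h] in a complement of the kernel: this is a system of at
   most [#|good| ^ 2] linear equations. *)
Lemma exists_interleaved_identity q n (f : {ffun 'S_q.+1 -> F}) :
  f 1%g != 0 -> mlin_identity A f -> (q ^ (8 * n) < n`!)%N ->
  exists g : {ffun 'S_n -> F}, g != 0 /\ interleaved_identity g.
Proof.
move=> f1 fid small.
(* Letters below [n] stand for the [x i], the next [n] for the [y i]; on these [2n] letters there
   are at most [q ^ (4n)] good words. *)
pose word (s : 'S_n) := flatten [seq [:: val (s i); (n + i)%N] | i <- enum 'I_n].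
have pword s : perm_eq (word s) (iota 0 (n + n)).
  rewrite (permPl (perm_eq_interleave _ _ _)) iotaD add0n.
  have -> : map (fun i : 'I_n => (n + i)%N) (enum 'I_n) = iota n n.
    by rewrite -[in RHS](addn0 n) iotaDl addn0 -val_enum_ord -map_comp.
  rewrite perm_cat2r -val_enum_ord (map_comp val s) perm_map //.
  apply: uniq_perm; [by rewrite (map_inj_uniq perm_inj) enum_uniq|exact: enum_uniq|].
  move=> i; rewrite mem_enum inE; apply/mapP.
  by exists (s^-1%g i); rewrite ?mem_enum ?permKV.
have /fin_all_exists[C CE] s := good_words_span f1 fid (pword s).
set gs := good_words q _ in CE; pose J := 'I_(size gs).
pose T s (j : J) := C s (nth [::] gs j).
have wordE (x y : 'I_n -> A) : exists V : J -> A, forall s : 'S_n,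
    \prod_(i < n) (x (s i) * y i) = \sum_j T s j *: V j.
  pose z k := if insub k is Some i then x i else
              if insub (k - n)%N is Some i then y i else 0.
  exists (fun j => wprod z (nth [::] gs j)) => s.
  transitivity (wprod z (word s)); last by rewrite CE (big_nth [::]) big_mkord.
  rewrite /word wprod_flatten big_enumT; apply: eq_bigr => i _.
  rewrite /wprod !big_cons big_nil mulr1 /z !valK; congr (_ * _).
  by rewrite insubF ?ltnNge ?leq_addr // addKn valK.
have [P PE] := generalized_inverse T.
(* [M t (j, k)] is coordinate [k] of [T] at the group algebra product [P j * t], so a solution [g]
   satisfies [T (P j * g) = 0] for all [j]. *)
pose M (t : 'S_n) (jk : J * J) := \sum_(s : 'S_n) P jk.1 s * T (s * t)%g jk.2.
have few : (#|{: J * J}| < #|'S_n|)%N.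
  rewrite card_prod card_ord card_Sn; apply: leq_ltn_trans small.
  apply: leq_trans (leq_mul (size_good_words _ _) (size_good_words _ _)) _.
  by rewrite -!expnD leq_eqVlt; apply/orP; left; apply/eqP; congr (_ ^ _)%N; lia.
have [g [gN0 gE]] := nontrivial_solution M few.
exists g; split=> // t x y.
pose h (s : 'S_n) : F := (s == t)%:R.
pose k s := h s - \sum_j (\sum_l h l * T l j) * P j s.
have hE s : h s = k s + \sum_j (\sum_l h l * T l j) * P j s by rewrite subrK.
have [V VE] := wordE x y.
transitivity (\sum_(s : 'S_n) g s *: \sum_(u : 'S_n) h u *: \sum_j T (u * s)%g j *: V j).
  apply: eq_bigr => s _; rewrite [in RHS](bigD1 t) //= /h eqxx scale1r [X in _ + X]big1 ?addr0; last first.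
    by move=> u /negbTE ->; rewrite scale0r.
  by rewrite -VE; congr (_ *: _); apply: eq_bigr => i _; rewrite permM.
have split_sum s : \sum_(u : 'S_n) h u *: (\sum_j T (u * s)%g j *: V j) =
   \sum_j (\sum_l h l * T l j) *: \sum_(u : 'S_n) P j u *: (\sum_j T (u * s)%g j *: V j).
  under eq_bigr => u _ do rewrite hE scalerDl scaler_suml.
  rewrite big_split /= exchange_big /= [X in X + _](_ : _ = 0) ?add0r; last first.
    (* A right factor [s] is absorbed by the substitution [x \o s], so the kernel part [k]
       contributes nothing. *)
    have [W WE] := wordE (x \o s) y.
    transitivity (\sum_u k u *: \sum_j T u j *: W j).
      apply: eq_bigr => u _; rewrite -VE -WE; congr (_ *: _).
      by apply: eq_bigr => i _; rewrite permM.
    under eq_bigr => u _ do (rewrite scaler_sumr; under eq_bigr => j _ do rewrite scalerA).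
    rewrite exchange_big big1 //= => j _; rewrite -scaler_suml.
    by rewrite -/T /k PE scale0r.
  by apply: eq_bigr => j _; rewrite scaler_sumr; apply: eq_bigr => u _; rewrite scalerA.
under eq_bigr => s _ do rewrite split_sum scaler_sumr.
rewrite exchange_big big1 //= => j _.
under eq_bigr => s _ do rewrite scalerA mulrC -scalerA.
rewrite -scaler_sumr.
have collect (s : 'S_n) : \sum_(u : 'S_n) P j u *: (\sum_i T (u * s)%g i *: V i) =
    \sum_i M s (j, i) *: V i.
  under eq_bigr => u _ do rewrite scaler_sumr.
  rewrite exchange_big; apply: eq_bigr => i _; rewrite scaler_suml.
  by apply: eq_bigr => u _; rewrite scalerA.
rewrite [X in _ *: X](_ : _ = 0) ?scaler0 //.
under eq_bigr => s _.
  rewrite collect scaler_sumr; under eq_bigr => i _ do rewrite scalerA.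
  over.
rewrite exchange_big big1 //= => i _.
by rewrite -scaler_suml gE scale0r.
Qed.

(** The translation is absorbed by [t]. It will bring a nonzero coefficient of [g] to the identity
    permutation. *)
Lemma interleaved_identity_mull n (g : {ffun 'S_n -> F}) (u : 'S_n) :
  interleaved_identity g -> interleaved_identity [ffun s => g (u * s)%g].
Proof.
move=> gid t x y; rewrite (reindex_inj (mulgI u^-1%g)) -[RHS](gid (t * u^-1)%g x y).
apply: eq_bigr => s _; rewrite ffunE mulKVg; congr (_ *: _).
by apply: eq_bigr => i _; rewrite !permM.
Qed.

(* The positions [j] of a word carry the letters [M s j]; those indexed by
   [iota] hold the permuted variables, the other ones are constant. *)
Lemma interleaved_identity_word n (g : {ffun 'S_n -> F}) (I : eqType) (w : seq I)
    (iota : 'I_n -> I) (M : 'S_n -> I -> A) (x L R : 'I_n -> A) (B : I -> A) :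
  interleaved_identity g -> uniq w -> injective iota -> (forall i, iota i \in w) ->
  (forall s i, M s (iota i) = L i * x (s i) * R i) ->
  (forall s j, j \notin codom iota -> M s j = B j) ->
  \sum_(s : 'S_n) g s *: \prod_(j <- w) M s j = 0.
Proof.
move=> gid uw iota_inj iota_w M_iota M_other.
(* Merge the constant factors: [y0] collects what precedes the first variable, [p.2] what lies
   between the variable [p.1] and the next one. *)
have [y0 [l [lE ME]]] : exists y0 (l : seq ('I_n * A)),
    [seq iota p.1 | p <- l] = [seq j <- w | j \in codom iota] /\
    forall s : 'S_n, \prod_(j <- w) M s j = y0 * \prod_(p <- l) (x (s p.1) * p.2).
  elim: w {uw iota_w} => [|j w [y0 [l [lE ME]]]].
    by exists 1, [::]; split=> // s; rewrite !big_nil mulr1.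
  case: (boolP (j \in codom iota)) => [/codomP[i ->]|jN].
    exists (L i), ((i, R i * y0) :: l); rewrite /= codom_f lE; split=> // s.
    by rewrite !big_cons ME M_iota /= !mulrA.
  exists (B j * y0), l; rewrite /= (negbTE jN) lE; split=> // s.
  by rewrite big_cons ME (M_other _ _ jN) mulrA.
pose js := map fst l.
have jsE : map iota js = [seq j <- w | j \in codom iota] by rewrite -map_comp.
have ujs : uniq js by rewrite -(map_inj_uniq iota_inj) jsE filter_uniq.
have mem_js i : i \in js.
  by rewrite -(mem_map iota_inj) jsE mem_filter codom_f iota_w.
have sz : size l = n.
  rewrite -(size_map fst) -/js -(card_uniqP ujs) -[RHS]card_ord.
  by apply: eq_card => i; rewrite mem_js.
have [lt ltE] : exists lt : n.-tuple ('I_n * A), l = lt.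
  by exists (Tuple (introT eqP sz)).
(* The order in which the variables occur in [w] supplies the permutation [t] of
   [interleaved_identity]. *)
have /tuple_uniqP t_inj : uniq (map_tuple fst lt) by rewrite /= -ltE.
transitivity (y0 * \sum_(s : 'S_n) g s *:
    \prod_(i < n) (x (s (perm t_inj i)) * (tnth lt i).2)).
  rewrite mulr_sumr; apply: eq_bigr => s _; rewrite ME -scalerAr ltE big_tuple.
  by congr (_ *: (_ * _)); apply: eq_bigr => i _; rewrite permE tnth_map.
by rewrite gid mulr0.
Qed.

Lemma ext_val_lt n m (s : 'S_n) (i : 'I_m) : (n <= m)%N -> (ext_val s i < m)%N.
Proof.
by rewrite /ext_val => nm; case: insubP => [j _ _|_]; [exact: leq_trans (ltn_ord _) nm|exact: ltn_ord].
Qed.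

Definition ext_fun n m (nm : (n <= m)%N) (s : 'S_n) (i : 'I_m) : 'I_m :=
  Ordinal (ext_val_lt s i nm).

Lemma ext_fun_inj n m (nm : (n <= m)%N) (s : 'S_n) : injective (ext_fun nm s).
Proof.
move=> i i' /(congr1 val) /=; rewrite /ext_val.
case: insubP => [j _ jE|iN]; case: insubP => [j' _ j'E|i'N] E; apply: val_inj => //=.
- by rewrite -jE -j'E; move/val_inj/perm_inj: E => ->.
- by move: i'N; rewrite -E ltn_ord.
- by move: iN; rewrite E ltn_ord.
Qed.

Lemma embed_mlin_sum n m (nm : (n <= m)%N) (g : {ffun 'S_n -> F}) (Phi : 'S_m -> A) :
  \sum_(u : 'S_m) embed_mlin m g u *: Phi u =
  \sum_(s : 'S_n) g s *: Phi (perm (@ext_fun_inj n m nm s)).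
Proof.
under eq_bigr => u _ do rewrite ffunE scaler_suml big_mkcond.
rewrite exchange_big; apply: eq_bigr => s _; rewrite -big_mkcond /=.
rewrite (big_pred1 (perm (@ext_fun_inj n m nm s))) // => u.
apply/forallP/eqP => [uE|-> i]; last by rewrite permE.
by apply/permP => i; apply/val_inj/eqP; rewrite permE /= uE.
Qed.

(** Since [(s * v) i = v (s i)], a right factor renames variables, while a left factor permutes
    places. *)
Lemma mlin_eval_mul m (f h : {ffun 'S_m -> F}) (x : 'I_m -> A) :
  mlin_eval (galg_mul f h) x = \sum_(v : 'S_m) h v *: mlin_eval f (x \o v).
Proof.
rewrite /mlin_eval /galg_mul; under [RHS]eq_bigr => v _ do rewrite scaler_sumr.
rewrite [RHS]exchange_big /=; under [LHS]eq_bigr => r _ do rewrite ffunE scaler_suml.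
rewrite [LHS]exchange_big; apply: eq_bigr => s _; rewrite (reindex_inj (mulgI s)) /=.
apply: eq_bigr => v _; rewrite mulKg scalerA mulrC; congr (_ *: _).
by apply: eq_bigr => i _; rewrite permM.
Qed.

(** The right factor only renames variables. The left factor scatters the variables of [g] among the
    remaining ones, which then act as the inserted elements. *)
Lemma interleaved_identity_strong n (g : {ffun 'S_n -> F}) :
  g != 0 -> interleaved_identity g -> strong_identity A g.
Proof.
move=> gN0 gid; split=> // m nm a b x; rewrite mlin_eval_mul big1 // => v _.
rewrite mlin_eval_mul; set xv := x \o v.
transitivity (b v *: \sum_(u : 'S_m) embed_mlin m g u *: \sum_(t : 'S_m) a t *: \prod_i xv (u (t i))).
  by [].
rewrite (embed_mlin_sum nm).
under eq_bigr => s _ do rewrite scaler_sumr.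
rewrite exchange_big big1 ?scaler0 //= => t _.
under eq_bigr => s _ do rewrite scalerA mulrC -scalerA.
rewrite -scaler_sumr [X in _ *: X](_ : _ = 0) ?scaler0 //.
pose M (s : 'S_n) (j : 'I_m) := xv (perm (@ext_fun_inj n m nm s) j).
transitivity (\sum_(s : 'S_n) g s *: \prod_(j <- map t (enum 'I_m)) M s j).
  by apply: eq_bigr => s _; rewrite big_map big_enumT.
apply: (@interleaved_identity_word n g _ _ (widen_ord nm) M (xv \o widen_ord nm)
  (fun=> 1) (fun=> 1) xv gid).
- by rewrite (map_inj_uniq perm_inj) enum_uniq.
- by move=> i j /(congr1 val) /= /val_inj.
- by move=> i; apply/mapP; exists (t^-1%g (widen_ord nm i)); rewrite ?mem_enum ?permKV.
- move=> s i; rewrite mul1r mulr1 /M /=; congr xv; apply: val_inj.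
  by rewrite permE /= /ext_val /= valK.
- move=> s j jN; rewrite /M; congr xv; apply: val_inj; rewrite permE /= /ext_val.
  case: insubP => // i _ iE; case/negP: jN; apply/codomP; exists i.
  exact: val_inj.
Qed.
End StrongIdentities.

(** * Rearrangement inequality and coding of words *)

(** Exchanging the values of a permutation at its first moved point [i] and at the preimage of [i]
    lowers the sum, so 1 is the only minimizer. *)
Lemma strict_rearrangement n (b : 'I_n -> nat) (s : 'S_n) :
  (forall i j : 'I_n, (i < j)%N -> (b j < b i)%N) -> s != 1%g ->
  (\sum_(i < n) i * b i < \sum_(i < n) i * b (s i))%N.
Proof.
move=> bdec sN1; pose S (t : 'S_n) := (\sum_(i < n) i * b (t i))%N.
have improve (t : 'S_n) : t != 1%g -> exists t', (S t' < S t)%N.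
  move=> tN1; have [i [iti fixed]] := first_moved_point tN1.
  pose k := t^-1%g i; have tk : t k = i by rewrite permKV.
  have ik : (i < k)%N.
    have kNi : k != i by apply: contraTneq iti => ki; rewrite -{2}ki tk ltnn.
    rewrite ltn_neqAle eq_sym kNi leqNgt; apply/negP => /fixed E.
    by move: kNi; rewrite -tk E eqxx.
  exists (tperm i k * t)%g; rewrite /S (bigD1 i) //= (bigD1 k) /=; last by rewrite neq_ltn ik orbT.
  rewrite [ltnRHS](bigD1 i) //= [in ltnRHS](bigD1 k) /=; last by rewrite neq_ltn ik orbT.
  rewrite !permM tpermL tpermR tk.
  rewrite (eq_bigr (fun j : 'I_n => j * b (t j)))%N; last first.
    by move=> j /andP[ji jk]; rewrite permM tpermD // eq_sym.
  have := bdec _ _ iti; nia.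
case: (@arg_minnP _ 1%g predT S isT) => t _ tmin.
have t1 : t = 1%g.
  by apply/eqP/negPn/negP => /improve[t']; rewrite ltnNge tmin.
have -> : (\sum_(i < n) i * b i)%N = S t.
  by rewrite t1; apply: eq_bigr => i _; rewrite perm1.
rewrite ltnNge; apply/negP => le_s.
by have [t'] := improve s sN1; rewrite ltnNge (leq_trans le_s) ?tmin.
Qed.

Lemma sum_codom n N (iota : 'I_n -> 'I_N) (E : 'I_N -> nat) : injective iota ->
  (\sum_j E j = \sum_(i < n) E (iota i) + \sum_(j | j \notin codom iota) E j)%N.
Proof.
move=> iota_inj; rewrite (bigID (mem (codom iota))) /=; congr (_ + _)%N.
have uc : uniq (codom iota) by rewrite map_inj_uniq ?enum_uniq.
by rewrite -(big_uniq _ uc) codomE big_map big_enum.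
Qed.

(* The value in base [r] of [w], least significant digit first, completed by a
   leading digit 1 that makes the code depend on the length of [w]. *)
Fixpoint word_code (r : nat) (w : seq 'I_r) : nat :=
  if w is a :: w' then (word_code w' * r + a)%N else 1%N.

Lemma word_code_gt0 r (w : seq 'I_r) : (0 < word_code w)%N.
Proof.
elim: w => //= a w IH; rewrite addn_gt0 muln_gt0 IH /=.
by rewrite (leq_trans _ (ltn_ord a)).
Qed.

Lemma word_code_bound r (w : seq 'I_r) : (word_code w < 2 * r ^ size w)%N.
Proof.
elim: w => //= a w IH; rewrite expnS mulnCA.
apply: (@leq_trans ((word_code w).+1 * r)); last by rewrite mulnC leq_mul2l IH orbT.
by rewrite mulSn [(r + _)%N]addnC -addnS leq_add2l.
Qed.

Lemma word_code_inj r : (2 <= r)%N -> injective (@word_code r).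
Proof.
move=> r2; have r0 : (0 < r)%N by apply: leq_trans r2.
have gt1 a (w : seq 'I_r) : (1 < word_code (a :: w))%N.
  by have /= := word_code_gt0 w; nia.
elim=> [|a w IH] [|a' w'] // E; try by [have := gt1 a' w'; rewrite -E|have := gt1 a w; rewrite E].
move: E => /= E; have /val_inj -> : val a = val a'.
  by have := congr1 (modn^~ r) E; rewrite /= !modnMDl !modn_small.
congr (_ :: _); apply: IH.
by have := congr1 (divn^~ r) E; rewrite /= !divnMDl // !divn_small // !addn0.
Qed.

(** * Capelli identities of affine algebras *)

Section Capelli.
Variables (F : fieldType) (A : algType F).

Definition capelli N (x y : 'I_N -> A) : A :=
  \sum_(p : 'S_N) ((-1) ^+ odd_perm p : F) *: \prod_(i < N) (x (p i) * y i).

Lemma capelli_repeat N (x y : 'I_N -> A) j k : j != k -> x j = x k ->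
  capelli x y = 0.
Proof.
move=> jk xjk; apply: (@signed_sum_eq0 _ _ _ (fun p => p * tperm j k)%g).
- exact: mulIg.
- by move=> p; rewrite odd_permM odd_tperm jk addbT.
- move=> p; apply: eq_bigr => i _; rewrite permM; congr (_ * _).
  by case: tpermP => // ->.
Qed.

(** Covers the case of at most one generator, since the count of short words assumes [2 <= r]. *)
Lemma capelli_comm N : (forall a b : A, a * b = b * a) -> (1 < N)%N ->
  satisfies_Capelli A N.
Proof.
case: N => [|[|N]] // AC _ x y.
pose k : 'I_N.+2 := lift ord0 ord0; have kN0 : ord0 != k by [].
apply: (@signed_sum_eq0 _ _ _ (fun p => tperm ord0 k * p)%g).
- exact: mulgI.
- by move=> p; rewrite odd_permM odd_tperm kN0.
- move=> p; rewrite !big_ord_recl !permM tpermL tpermR !mulrA.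
  congr (_ * _).
    by congr (_ * _); rewrite [LHS]AC -!mulrA; congr (_ * _); apply: AC.
  by apply: eq_bigr => i _; rewrite permM tpermD.
Qed.

Variables (r : nat) (a : 'I_r -> A).

Definition ev (w : seq 'I_r) : A := \prod_(i <- w) a i.

Lemma generates_comm : (r <= 1)%N -> generates a -> forall u v : A, u * v = v * u.
Proof.
move=> r1 gen u v; have [s ->] := gen u; have [s' ->] := gen v.
have ev_comm (w w' : seq 'I_r) : GRing.comm (ev w) (ev w').
  apply: commr_prod => i _; apply/commr_sym/commr_prod => j _.
  suff -> : i = j by [].
  by apply: val_inj => /=; move: (ltn_ord i) (ltn_ord j); lia.
apply: commr_sum => p _; apply/commr_sym/commr_sum => p' _; rewrite /GRing.comm.
by rewrite -!scalerAl -!scalerAr !scalerA mulrC ev_comm.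
Qed.

Lemma capelli_generates N : generates a ->
  (forall (W : 'I_N -> seq 'I_r) (y : 'I_N -> A), capelli (ev \o W) y = 0) ->
  satisfies_Capelli A N.
Proof.
move=> gen capW x y.
have /fin_all_exists[s sE] j := gen (x j).
pose M := (\max_j size (s j))%N.
(* Padding with zero terms gives all expansions the common length [M]. *)
pose t j (k : 'I_M) := nth (0, [::]) (s j) k.
have xE j : x j = \sum_(k < M) (t j k).1 *: ev (t j k).2.
  have sM : (size (s j) <= M)%N by apply: (leq_bigmax (F := fun j => size (s j))).
  rewrite sE (big_nth (0, [::])) big_mkord.
  rewrite (big_ord_widen M (fun k => (nth (0, [::]) (s j) k).1 *: ev (nth (0, [::]) (s j) k).2) sM).
  rewrite big_mkcond /=; apply: eq_bigr => k _; case: ifP => // kN.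
  by rewrite /t nth_default ?scale0r // leqNgt kN.
transitivity (\sum_(phi : {ffun 'I_N -> 'I_M})
   (\prod_j (t j (phi j)).1) *: capelli (ev \o (fun j => (t j (phi j)).2)) y); last first.
  by rewrite big1 // => phi _; rewrite capW scaler0.
under [RHS]eq_bigr => phi _ do rewrite scaler_sumr.
rewrite [RHS]exchange_big /=; apply: eq_bigr => p _.
under [RHS]eq_bigr => phi _ do rewrite scalerA mulrC -scalerA.
rewrite -[RHS]scaler_sumr; congr (_ *: _).
under eq_bigr => i _ do rewrite xE mulr_suml.
rewrite (bigA_distr_bigA (fun i k => (t (p i) k).1 *: ev (t (p i) k).2 * y i)).
(* Terms were chosen by position; [h] indexes the choices by variable instead. *)
pose h (phi : {ffun 'I_N -> 'I_M}) := [ffun i => phi (p i)].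
rewrite (reindex h) /=; last first.
  exists (fun phi : {ffun 'I_N -> 'I_M} => [ffun i => phi (p^-1%g i)]) => phi _;
    by apply/ffunP => i; rewrite !ffunE ?permKV ?permK.
apply: eq_bigr => phi _; rewrite (reindex_perm p) -scaler_prod.
by apply: eq_bigr => i _; rewrite ffunE -scalerAl.
Qed.

(** Words shorter than [D] have distinct codes below [2 * r ^ (D - 1) <= r ^ D], so at least [D] of
    the [W j] are long; take the [D] longest. *)
Lemma long_words D N (W : 'I_N -> seq 'I_r) : (2 <= r)%N -> (r ^ D + D <= N)%N ->
  injective W -> exists iota : 'I_D -> 'I_N,
  [/\ injective iota, forall i, (D <= size (W (iota i)))%N &
      forall i j : 'I_D, (i < j)%N -> (size (W (iota j)) <= size (W (iota i)))%N].
Proof.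
move=> r2 DN W_inj; pose long := [pred j | (D <= size (W j))%N].
pose le j k := (size (W k) <= size (W j))%N.
pose l := sort le (enum long).
have le_tr : transitive le by move=> x y z xy yz; apply: leq_trans yz xy.
have le_refl : reflexive le by move=> x; apply: leqnn.
have srt : sorted le l by apply: sort_sorted => x y; apply: leq_total.
have card_short : (#|[predC long]| <= r ^ D)%N.
  case: D @long @l srt DN => [|D] long l srt DN.
    by rewrite (eq_card (B := pred0)) ?card0.
  have r0 : (0 < r ^ D.+1)%N by rewrite expn_gt0 (leq_trans _ r2).
  rewrite -[leqRHS]card_ord -(prednK r0).
  have code_lt j : j \in [predC long] -> (word_code (W j) < (r ^ D.+1).-1.+1)%N.
    rewrite !inE -ltnNge prednK // => short.
    apply: leq_trans (word_code_bound _) _; rewrite expnS leq_mul // leq_pexp2l //.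
    exact: leq_trans r2.
  rewrite -(@card_in_image _ _ (fun j => inord (word_code (W j)) : 'I_(r ^ D.+1).-1.+1)).
    exact: max_card.
  move=> j k /code_lt jlt /code_lt klt /(congr1 val) /=; rewrite !inordK //.
  by move/(word_code_inj r2)/W_inj.
have card_long : (D <= size l)%N.
  rewrite size_sort -cardE -(leq_add2r #|[predC long]|) cardC card_ord.
  by apply: leq_trans DN; rewrite addnC leq_add2r.
case: N => [|N] in W DN W_inj long le l le_tr le_refl srt card_short card_long *.
  have D0 : D = 0%N by move: DN; lia.
  by subst D; exists (fun i : 'I_0 => False_rect _ (notF (ltn_ord i))); split=> [[]|[]|[]].
have ul : uniq l by rewrite sort_uniq enum_uniq.
have lt_l (i : 'I_D) : (i < size l)%N by apply: leq_trans card_long.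
exists (fun i => nth ord0 l i); split.
- by move=> i j /eqP; rewrite nth_uniq // => /eqP/val_inj.
- by move=> i; have := mem_nth ord0 (lt_l i); rewrite mem_sort mem_enum.
- by move=> i j ij; apply: (sorted_leq_nth le_tr le_refl ord0 srt); rewrite ?inE // ltnW.
Qed.

(* Write the long words as [W (iota i) = v i ++ z i], the lengths of the [v i]
   increasing and those of the [z i] decreasing. The identity rewrites the
   Capelli polynomial in terms of those at the words [v i ++ z (s i)], [s != 1],
   which have the same total length and a larger sum of squared lengths. *)
Lemma capelli_words D N (g : {ffun 'S_D -> F}) : (2 <= r)%N -> (r ^ D + D <= N)%N ->
  g 1%g != 0 -> interleaved_identity A g ->
  forall (W : 'I_N -> seq 'I_r) (y : 'I_N -> A), capelli (ev \o W) y = 0.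
Proof.
move=> r2 DN g1 gid W y; pose total (W : 'I_N -> seq 'I_r) := (\sum_j size (W j))%N.
pose squares (W : 'I_N -> seq 'I_r) := (\sum_j size (W j) ^ 2)%N.
have squares_le V : (squares V <= total V ^ 2)%N.
  rewrite -mulnn {1}/total big_distrl leq_sum //= => j _.
  by rewrite -mulnn leq_mul2l /total (bigD1 j) //= leq_addr orbT.
(* [total] is preserved by the rewriting, so the bound [total W ^ 2] on [squares] stays fixed and
   the gap decreases. *)
have [k] := ubnP (total W ^ 2 - squares W)%N.
elim: k => // k IH in W *; rewrite ltnS => small.
case: (boolP (injectiveb W)) => [/injectiveP W_inj|/injectivePn[j [j' jj' Wjj']]]; last first.
  by apply: (capelli_repeat _ jj'); rewrite /= Wjj'.
have [iota [iota_inj long dec]] := long_words r2 DN W_inj.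
pose Ws (s : 'S_D) j := if [pick i | iota i == j] is Some i
  then take i (W (iota i)) ++ drop (s i) (W (iota (s i))) else W j.
have Ws_iota s i : Ws s (iota i) = take i (W (iota i)) ++ drop (s i) (W (iota (s i))).
  rewrite /Ws; case: pickP => [i' /eqP/iota_inj -> //|/(_ i)]; by rewrite eqxx.
have Ws_other s j : j \notin codom iota -> Ws s j = W j.
  rewrite /Ws; case: pickP => // i /eqP <-; by rewrite codom_f.
have Ws1 j : Ws 1%g j = W j.
  case: (boolP (j \in codom iota)) => [/codomP[i ->]|/Ws_other //].
  by rewrite Ws_iota perm1 cat_take_drop.
pose b i := (size (W (iota i)) - i)%N.
have size_W i : size (W (iota i)) = (i + b i)%N.
  by rewrite subnKC // ltnW // (leq_trans (ltn_ord i)).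
have size_Ws s i : size (Ws s (iota i)) = (i + b (s i))%N.
  rewrite Ws_iota size_cat size_drop size_takel //.
  by rewrite ltnW // (leq_trans (ltn_ord i)).
have bdec (i j : 'I_D) : (i < j)%N -> (b j < b i)%N.
  move=> ij; have := dec _ _ ij; have := long j; have := ltn_ord j.
  by rewrite /b; lia.
have total_Ws s : total (Ws s) = total W.
  rewrite /total !(sum_codom _ iota_inj); congr (_ + _)%N; last first.
    by apply: eq_bigr => j /Ws_other ->.
  under eq_bigr => i _ do rewrite size_Ws.
  under [RHS]eq_bigr => i _ do rewrite size_W.
  by rewrite !big_split /= [X in _ = (_ + X)%N](reindex_perm s).
have squares_Ws s : s != 1%g -> (squares W < squares (Ws s))%N.
  move=> sN1; rewrite /squares !(sum_codom _ iota_inj).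
  rewrite [X in (_ < _ + X)%N](eq_bigr (fun j => size (W j) ^ 2)%N) ?ltn_add2r; last first.
    by move=> j /Ws_other ->.
  (* After expanding the squares only the sum of the cross terms changes, and it grows by
     rearrangement. *)
  under eq_bigr => i _ do rewrite size_W sqrnD.
  under [ltnRHS]eq_bigr => i _ do rewrite size_Ws sqrnD.
  rewrite !big_split /= [X in (_ + X + _ < _)%N](reindex_perm s) /=.
  have lt := strict_rearrangement bdec sN1.
  by rewrite ltn_add2l -addSn leq_add // leq_add2r ltnW.
have caps : \sum_(s : 'S_D) g s *: capelli (ev \o Ws s) y = 0.
  under eq_bigr => s _ do rewrite scaler_sumr.
  rewrite exchange_big big1 //= => p _.
  under eq_bigr => s _ do rewrite scalerA mulrC -scalerA.
  rewrite -scaler_sumr [X in _ *: X](_ : _ = 0) ?scaler0 //.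
  (* Each tail [drop] is a permuted variable, with the head [take] as left factor and a [y] as right
     factor. *)
  pose M (s : 'S_D) j := ev (Ws s j) * y (p^-1%g j).
  transitivity (\sum_(s : 'S_D) g s *: \prod_(j <- map p (enum 'I_N)) M s j).
    apply: eq_bigr => s _; rewrite big_map big_enumT; congr (_ *: _).
    by apply: eq_bigr => i _; rewrite /M permK.
  apply: (@interleaved_identity_word _ _ D g _ _ iota M
    (fun i => ev (drop i (W (iota i)))) (fun i => ev (take i (W (iota i))))
    (fun i => y (p^-1%g (iota i))) (fun j => ev (W j) * y (p^-1%g j))) => //.
  - by rewrite (map_inj_uniq perm_inj) enum_uniq.
  - by move=> i; apply/mapP; exists (p^-1%g (iota i)); rewrite ?mem_enum ?permKV.
  - by move=> s i; rewrite /M Ws_iota /ev big_cat.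
  - by move=> s j jN; rewrite /M Ws_other.
have -> : capelli (ev \o W) y = capelli (ev \o Ws 1%g) y.
  by apply: eq_bigr => p _; congr (_ *: _); apply: eq_bigr => i _; rewrite /= Ws1.
move: caps; rewrite (bigD1 1%g) //= big1 => [/eqP|s sN1].
  by rewrite addr0 scaler_eq0 (negbTE g1) => /eqP.
rewrite IH ?scaler0 // total_Ws; apply: leq_trans small.
by have := squares_Ws s sN1; have := squares_le (Ws s); rewrite total_Ws; lia.
Qed.
End Capelli.

(** * Numerical estimates for [dprime] *)

Local Notation R := Rdefinitions.R.
Local Notation exp := Rtrigo_def.exp.

Lemma exp_ge1D (a : R) : 1 + a <= exp a.
Proof. by apply/RleP; apply: Rpower.exp_ineq1_le. Qed.

Lemma exprn_exp (a : R) k : exp a ^+ k = exp (a *+ k).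
Proof.
elim: k => [|k IH]; first by rewrite expr0 mulr0n Rtrigo_def.exp_0.
by rewrite exprS mulrS IH -[RHS]/(exp (Rdefinitions.Rplus a (a *+ k))) Exp_prop.exp_plus.
Qed.

(** This is [(1 + 1/k) ^ k <= e <= 3], from [1 + a <= exp a] at [a = 1/k]. *)
Lemma expn_succ_le3 k : (k.+1 ^ k <= 3 * k ^ k)%N.
Proof.
case: k => [|k] //; set n := k.+1.
have n0 : (n%:R : R) != 0 by rewrite pnatr_eq0.
rewrite -(ler_nat R) natrM !natrX.
have -> : n.+1%:R = n%:R * (1 + n%:R^-1) :> R by rewrite mulrDr mulr1 mulfV // -natr1.
rewrite exprMn mulrC ler_wpM2r ?exprn_ge0 ?ler0n //.
apply: (@le_trans _ _ (exp n%:R^-1 ^+ n)).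
  by apply: lerXn2r; rewrite ?nnegrE ?exp_ge1D // ?addr_ge0 ?invr_ge0 ?ler0n //;
     apply: le_trans (exp_ge1D _); rewrite addr_ge0 ?invr_ge0 ?ler0n.
rewrite exprn_exp -[_^-1 *+ _]mulr_natr mulVf //.
by apply/RleP; rewrite -INRE RIneq.INR_IZR_INZ; apply: Rpower.exp_le_3.
Qed.

Lemma expnn_le_fact n : (n ^ n <= 3 ^ n * n`!)%N.
Proof.
elim: n => // n IH; rewrite factS !expnS.
have := expn_succ_le3 n; nia.
Qed.

(** The crude bound [2 <= e] gives [(2 * q ^ 4) ^ 2]; its factor 4 beats the 3 in
    [expnn_le_fact]. *)
Lemma dprime_ge q : (4 * q ^ 8 <= dprime q.+1)%N.
Proof.
have e2 : 2 <= exp 1 :> R by apply: exp_ge1D.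
rewrite /dprime /e_ceil /=; set c := Num.ceil _.
have c_ge : 2 * (q ^ 4)%:R <= c%:~R :> R.
  by apply: le_trans (ceil_ge _); rewrite ler_wpM2r ?ler0n.
have : (2 * q ^ 4 <= `|c|)%N.
  have c0 : 0 <= c by rewrite -(ler0z R); apply: le_trans c_ge; rewrite mulr_ge0 ?ler0n.
  by rewrite -(ler_nat R) natrM natr_absz ger0_norm.
by rewrite -leq_sqr expnMn -expnM.
Qed.

Lemma expn_dprime_lt_fact q : (0 < q)%N -> (q ^ (8 * dprime q.+1) < (dprime q.+1)`!)%N.
Proof.
move=> q0; have := dprime_ge q; set n := dprime _ => n_ge.
have n0 : (0 < n)%N by apply: leq_trans n_ge; rewrite muln_gt0 expn_gt0 q0.
rewrite -(ltn_pmul2l (_ : 0 < 3 ^ n)%N) ?expn_gt0 //.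
apply: leq_trans (expnn_le_fact n).
apply: (@leq_trans ((4 * q ^ 8) ^ n)); last by rewrite leq_exp2r.
by rewrite expnMn -expnM ltn_pmul2r ?ltn_exp2r // expn_gt0 q0.
Qed.

Theorem theorem3p17 (F : fieldType) (hF : [pchar F] =i pred0)
  (A : algType F) (d : nat) (hPI : has_PI_of_degree A d) :
  (exists g : {ffun 'S_(dprime d) -> F}, strong_identity A g) /\
  (forall (r : nat) (a : 'I_r -> A), generates a ->
     satisfies_Capelli A (r ^ dprime d + dprime d)%N) /\
  (forall (r : nat) (a : 'I_r -> A), generates a ->
     exists n : nat, satisfies_Capelli A n).
Proof.
have [f [f1 fid]] := multilinearization hPI.
(* For [d <= 1] the group ['S_d] is trivial, and evaluation at 1 would give [f 1 = 0]. *)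
have d2 : (2 <= d)%N.
  rewrite ltnNge; apply/negP => d1; case/eqP: f1.
  have := fid (fun=> 1); rewrite /mlin_eval (big_pred1 1%g) => [|s].
    by rewrite big1 // => /eqP; rewrite scaler_eq0 oner_eq0 orbF => /eqP.
  apply/esym/eqP/permP => i; rewrite perm1; apply: val_inj => /=.
  by move: (ltn_ord i) (ltn_ord (s i)); lia.
case: d d2 f f1 fid {hPI} => [|[|q]] // _ f f1 fid.
have [g [gN0 gid]] := exists_interleaved_identity f1 fid (expn_dprime_lt_fact (ltn0Sn q)).
have D2 : (2 <= dprime q.+2)%N.
  by apply: leq_trans (dprime_ge q.+1); rewrite (@leq_trans 4) // leq_pmulr // expn_gt0.
set D := dprime q.+2 in g gN0 gid D2 *.
have cap r (a : 'I_r -> A) : generates a -> satisfies_Capelli A (r ^ D + D)%N.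
  move=> gen; case: (leqP r 1) => [r1|r2].
    by apply: capelli_comm (generates_comm r1 gen) _; rewrite (leq_trans D2) ?leq_addl.
  (* A translate of [g] has a nonzero coefficient at 1, which allows solving for the original
     Capelli term. *)
  have [u gu] : exists u, g u != 0.
    apply/existsP; apply: contraNT gN0 => /existsPn g0.
    by apply/eqP/ffunP => u; rewrite ffunE; apply/eqP; rewrite -[_ == _]negbK g0.
  have gu1 : [ffun s => g (u * s)%g] 1%g != 0 by rewrite ffunE mulg1.
  apply: (capelli_generates gen).
  exact: (capelli_words a r2 (leqnn _) gu1 (interleaved_identity_mull u gid)).
split; first by exists g; apply: interleaved_identity_strong.
split=> [r a gen|r a gen]; first exact: cap gen.
by exists (r ^ D + D)%N; apply: cap gen.
Qed.
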